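(* The forcing $\mathbb{P}_{\neq^*}$ collapses the continuum to $\omega$ below some condition; that is, there is a condition $p\in\mathbb{P}_{\neq^*}$ forcing that the set of ground model reals $\omega^\omega\cap V$ is countable.
   Context: For $x,y\in\omega^\omega$, $x\neq^*y$ means $x(n)\neq y(n)$ for all but finitely many $n$. A set $A\subseteq\omega^\omega$ is $\neq^*$-$\omega$-dominating if for every countable $C\subseteq\omega^\omega$ there is $y\in A$ with $x\neq^*y$ for all $x\in C$. $\mathbb{P}_{\neq^*}$ is the forcing consisting of all Borel $\neq^*$-$\omega$-dominating subsets of $\omega^\omega$, ordered by inclusion. *)

(* Defs.v *)
From mathcomp Require Import all_boot all_order all_algebra.
From mathcomp Require Import all_classical all_reals all_analysis.

Set Implicit Arguments.
Unset Strict Implicit.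
Unset Printing Implicit Defensive.

Local Open Scope classical_set_scope.

(** * First-order formulas of the language of set theory

Higher-order abstract syntax: quantifiers bind a variable of the type [T] over
which the formula is interpreted.  Formulas below are defined uniformly in [T],
hence are genuine first-order formulas with parameters. *)

Inductive formula (T : Type) : Type :=
| FEq  : T -> T -> formula T
| FMem : T -> T -> formula T
| FNot : formula T -> formula T
| FAnd : formula T -> formula T -> formula T
| FOr  : formula T -> formula T -> formula T
| FImp : formula T -> formula T -> formula T
| FAll : (T -> formula T) -> formula T
| FEx  : (T -> formula T) -> formula T.

Definition FIff T (a b : formula T) := FAnd (FImp a b) (FImp b a).

Definition FAllIn T (a : T) (F : T -> formula T) :=
  FAll (fun x => FImp (FMem x a) (F x)).

Definition FExIn T (a : T) (F : T -> formula T) :=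
  FEx (fun x => FAnd (FMem x a) (F x)).

(** [z = {x, y}] *)
Definition is_upair T (z x y : T) : formula T :=
  FAll (fun w => FIff (FMem w z) (FOr (FEq w x) (FEq w y))).

(** [z = (x, y) = {{x}, {x, y}}] *)
Definition is_opair T (z x y : T) : formula T :=
  FAll (fun w => FIff (FMem w z) (FOr (is_upair w x x) (is_upair w x y))).

(** [(x, y) \in f] *)
Definition pair_in T (x y f : T) : formula T :=
  FExIn f (fun z => is_opair z x y).

Definition is_function T (f a b : T) : formula T :=
  FAnd (FAllIn f (fun z => FExIn a (fun x => FExIn b (fun y => is_opair z x y))))
 (FAnd (FAllIn a (fun x => FExIn b (fun y => pair_in x y f)))
       (FAll (fun x => FAll (fun y => FAll (fun y' =>
          FImp (FAnd (pair_in x y f) (pair_in x y' f)) (FEq y y')))))).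

Definition is_injective T (f : T) : formula T :=
  FAll (fun x => FAll (fun x' => FAll (fun y =>
    FImp (FAnd (pair_in x y f) (pair_in x' y f)) (FEq x x')))).

(** "[a] is countable", i.e. there is an injection of [a] into [w]; [w] is to
    be interpreted by [omega]. *)
Definition is_countable T (w a : T) : formula T :=
  FEx (fun f => FAnd (is_function f a w) (is_injective f)).

(** * Forcing notions, names and the forcing relation *)

Record forcing := Forcing {
  cond :> Type ;
  fle : cond -> cond -> Prop ;  (* [fle q p]: [q] is stronger than [p] *)
  fle_refl : forall p, fle p p ;
  fle_trans : forall p q r, fle p q -> fle q r -> fle p r ;
  fone : cond ;
  fle_one : forall p, fle p fone
}.

Section Forcing.
Variable P : forcing.

Definition dense_below (p : P) (D : P -> Prop) : Prop :=
  forall q, fle q p -> exists2 r, fle r q & D r.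

(** A [P]-name is a set of pairs (name, condition), given as a family. *)
Inductive name : Type := Name (A : Type) (s : A -> name) (c : A -> P).

(** [p] forces [x = y] iff every member of [x] is forced (below its condition)
    to be a member of [y], and conversely; the membership clause of
    [forces_mem] is inlined to make the recursion structural in [x]. *)
Fixpoint forces_eq (x y : name) (p : P) {struct x} : Prop :=
  match x, y with
  | Name A s c, Name B t d =>
      (forall i q, fle q p -> fle q (c i) ->
         dense_below q (fun r => exists2 j, fle r (d j) & forces_eq (s i) (t j) r))
   /\ (forall j q, fle q p -> fle q (d j) ->
         dense_below q (fun r => exists2 i, fle r (c i) & forces_eq (s i) (t j) r))
  end.

Definition forces_mem (x y : name) (p : P) : Prop :=
  let: Name B t d := y in
  dense_below p (fun r => exists2 j, fle r (d j) & forces_eq x (t j) r).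

Fixpoint forces (p : P) (phi : formula name) {struct phi} : Prop :=
  match phi with
  | FEq x y  => forces_eq x y p
  | FMem x y => forces_mem x y p
  | FNot a   => forall q, fle q p -> ~ forces q a
  | FAnd a b => forces p a /\ forces p b
  | FOr a b  => dense_below p (fun r => forces r a \/ forces r b)
  | FImp a b => forall q, fle q p -> forces q a -> forces q b
  | FAll F   => forall x, forces p (F x)
  | FEx F    => dense_below p (fun r => exists x, forces r (F x))
  end.

End Forcing.

(** * The ground model

The universe [V] is the type of well-founded sets, each set being given as a
family of its members. *)

Inductive vset : Type := VSet (A : Type) (s : A -> vset).

Fixpoint check (P : forcing) (x : vset) : name P :=
  let: VSet A s := x in Name (fun i : A => check P (s i)) (fun=> fone P).

Definition vempty : vset := VSet (fun e : Empty_set => match e with end).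

(** [x \cup {x}] *)
Definition vsucc (x : vset) : vset :=
  let: VSet A s := x in VSet (fun o : option A => if o is Some i then s i else x).

Definition vnat (n : nat) : vset := iter n vsucc vempty.

Definition vupair (x y : vset) : vset := VSet (fun b : bool => if b then x else y).

Definition vopair (x y : vset) : vset := vupair (vupair x x) (vupair x y).

Definition vomega : vset := VSet vnat.

(** The Baire space, with its product topology ([nat] is discrete). *)
Notation baire := {ptws nat -> nat}.

(** The graph of [x], as a set *)
Definition vreal (x : baire) : vset := VSet (fun n => vopair (vnat n) (vnat (x n))).

(** The set of all reals of [V] *)
Definition vreals : vset := VSet vreal.

(** * The forcing with Borel omega-dominating sets for eventual difference *)

Definition borel (A : set baire) : Prop := <<s [set U : set baire | open U] >> A.

Definition ev_diff (x y : baire) : Prop := \forall n \near \oo, x n <> y n.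

Definition omega_dominating (A : set baire) : Prop :=
  forall C : set baire, countable C ->
    exists2 y, A y & forall x, C x -> ev_diff x y.

Lemma borelT : borel [set: baire].
Proof. by apply: sub_sigma_algebra; exact: openT. Qed.

Lemma omega_dominatingT : omega_dominating [set: baire].
Proof.
move=> C /countable_injP [f finj].
pose z (i : nat) : baire := xget (cst 0) [set x | C x /\ f x = i].
exists (fun n => (\sum_(i < n.+1) z i n).+1) => // x Cx.
have zx : z (f x) = x.
  rewrite /z; case: xgetP => [y -> [Cy fy]|/(_ x)]; last by case.
  by apply: finj; rewrite ?inE.
exists (f x) => // n /= lefn xn.
have lt : (f x < n.+1)%N by rewrite ltnS.
have : (x n <= \sum_(i < n.+1) z i n)%N.
  by rewrite (bigD1 (Ordinal lt)) //= zx leq_addr.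
by rewrite xn ltnn.
Qed.

Record pneq_cond := PneqCond {
  pneq_set :> set baire ;
  pneq_borel : borel pneq_set ;
  pneq_dominating : omega_dominating pneq_set
}.

Definition Pneq : forcing := {|
  cond := pneq_cond ;
  fle p q := pneq_set p `<=` pneq_set q ;
  fle_refl p := @subset_refl _ (pneq_set p) ;
  fle_trans p q r := @subset_trans _ (pneq_set q) (pneq_set p) (pneq_set r) ;
  fone := PneqCond borelT omega_dominatingT ;
  fle_one p := @subsetT _ (pneq_set p)
|}.

(* Main.v *)
From mathcomp Require Import all_boot all_order all_algebra.
From mathcomp Require Import all_classical all_reals all_analysis.
From mathcomp Require Import zify.
Require Import Defs.

(** Read [y] as guessing binary sequences, each length [l] being guessed at
    infinitely many places, and let the unguessed tree of [y] consist of the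
    sequences that [y] never guesses. For a real [f], let [x_f i] be the initial
    segment of (a binary code of) [f] of the length guessed at [i]. If [y] is
    eventually different from [x_f], then [f] is, above some level [m], an infinite
    branch of the unguessed tree of [y]. The condition [p] consists of the [y] for
    which, for every [m], such a branch is determined by its first [a] bits, for
    some [a]; so for [y] in [p] each [f] with [y] eventually different from [x_f]
    gets a natural number label determining it, namely [m] and these [a] bits. For
    any [f] and any [q <= p], a countable set witnessing that no part of [q] with a
    fixed label for [f] is dominating, augmented with [x_f], would witness that
    [q] is not dominating. Hence labels give a name for an injection of the ground
    model reals into [omega].

    To see that [p] is dominating, let [c] enumerate a countable set. The sequences
    that [c 0], ..., [c k] prevent [y] from guessing form a set of width at most
    [k+1], hence with finitely many infinite branches. Avoiding only
    [c 0], ..., [c k] while guessing the sequences of lengths in a long interval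
    [l k <= |s| < l (k+1)], long enough for compactness to apply and for the finitely many
    branches at stage [k+1] to be distinguished, yields a [y] in [p]. *)

Set Implicit Arguments.
Unset Strict Implicit.
Unset Printing Implicit Defensive.

Local Open Scope classical_set_scope.

(** * The forcing relation *)

Section ForcingRelation.
Variable P : forcing.
Implicit Types (p q r : P) (x y z w : name P).

Lemma dense_mono p q (D : P -> Prop) :
  fle q p -> dense_below p D -> dense_below q D.
Proof. by move=> qp Dp r rq; apply: Dp; exact: fle_trans qp. Qed.

Lemma dense_self p (D : P -> Prop) : (forall q, fle q p -> D q) -> dense_below p D.
Proof. by move=> Dp q qp; exists q; [exact: fle_refl | exact: Dp]. Qed.

Lemma dense_bind p (D E : P -> Prop) : dense_below p D ->
  (forall q, fle q p -> D q -> dense_below q E) -> dense_below p E.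
Proof.
move=> Dp DE q qp; have [r rq Dr] := Dp _ qp.
have [s sr Es] := DE r (fle_trans rq qp) Dr r (fle_refl r).
by exists s => //; exact: fle_trans rq.
Qed.

Lemma forces_mono phi p q : fle q p -> forces p phi -> forces q phi.
Proof.
elim: phi p q => [x y|x y|a _|a IHa b IHb|a IHa b IHb|a _ b _|F IH|F IH] p q qp /=.
- case: x y => [A s c] [B t d] /= [h1 h2].
  split=> i r rq; [apply: h1 | apply: h2]; exact: fle_trans qp.
- by case: y => B t d; exact: dense_mono.
- by move=> h r rq; apply: h; exact: fle_trans qp.
- by move=> [ha hb]; split; [exact: IHa ha | exact: IHb hb].
- exact: dense_mono.
- by move=> h r rq; apply: h; exact: fle_trans qp.
- by move=> h x; exact: IH (h x).
- exact: dense_mono.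
Qed.

(** Clauses stated by density absorb a further density by [dense_bind]; for negation, one extension
    forcing both the formula and its negation is already absurd. Forced statements may thus be
    checked after passing to extensions. *)
Lemma forces_dense phi p : dense_below p (fun r => forces r phi) -> forces p phi.
Proof.
elim: phi p => [x y|x y|a _|a IHa b IHb|a IHa b IHb|a _ b IHb|F IH|F IH] p /=.
- case: x y => [A s c] [B t d] /= h; split=> i q qp qi.
    apply: (dense_bind (dense_mono qp h)) => r rq [h1 _].
    by apply: h1; [exact: fle_refl | exact: fle_trans qi].
  apply: (dense_bind (dense_mono qp h)) => r rq [_ h2].
  by apply: h2; [exact: fle_refl | exact: fle_trans qi].
- by case: y => B t d h; apply: dense_bind h _.
- move=> h q qp qa; have [r rq /(_ r (fle_refl r))] := h _ qp; apply.
  exact: forces_mono qa.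
- move=> h; split; [apply: IHa | apply: IHb]; apply: dense_bind h _ => q qp [ha hb];
    apply: dense_self => r rq; [exact: forces_mono rq ha | exact: forces_mono rq hb].
- by move=> h; apply: dense_bind h _.
- move=> h q qp qa; apply: IHb; apply: dense_bind (dense_mono qp h) _.
  move=> r rq hr; apply: dense_self => s sr; apply: hr => //.
  exact: forces_mono (fle_trans sr rq) qa.
- move=> h x; apply: IH; apply: dense_bind h _ => q qp hq.
  by apply: dense_self => r rq; exact: forces_mono rq (hq x).
- by move=> h; apply: dense_bind h _.
Qed.

Lemma forces_eq_mono x y p q : fle q p -> forces_eq x y p -> forces_eq x y q.
Proof. exact: (@forces_mono (FEq x y)). Qed.

Lemma forces_eq_dense x y p :
  dense_below p (forces_eq x y) -> forces_eq x y p.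
Proof. exact: (@forces_dense (FEq x y)). Qed.

Lemma forces_mem_dense x y p :
  dense_below p (forces_mem x y) -> forces_mem x y p.
Proof. exact: (@forces_dense (FMem x y)). Qed.

Lemma forces_eq_refl x p : forces_eq x x p.
Proof.
elim: x p => A s IH c p /=; split=> i q qp qi; apply: dense_self => r rq;
  by exists i; [exact: fle_trans qi | exact: IH].
Qed.

Lemma forces_eq_sym x y p : forces_eq x y p -> forces_eq y x p.
Proof.
elim: x y p => A s IH c [B t d] p /= [h1 h2]; split=> i q qp qi.
  by move=> r rq; have [u ur [j uj e]] := h2 _ _ qp qi _ rq;
     exists u => //; exists j => //; exact: IH.
by move=> r rq; have [u ur [j uj e]] := h1 _ _ qp qi _ rq;
   exists u => //; exists j => //; exact: IH.
Qed.

Lemma forces_eq_trans y x z p :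
  forces_eq x y p -> forces_eq y z p -> forces_eq x z p.
Proof.
elim: x y z p => A s IH c [B t d] [C u e] p /= [h1 h2] [k1 k2]; split=> i q qp qi.
  apply: dense_bind (h1 _ _ qp qi) _ => r rq [j rj e1].
  apply: dense_bind (k1 _ _ (fle_trans rq qp) rj) _ => v vr [l vl e2].
  apply: dense_self => a av; exists l; first exact: fle_trans vl.
  by apply: forces_eq_mono av _; apply: IH e2; exact: forces_eq_mono e1.
apply: dense_bind (k2 _ _ qp qi) _ => r rq [j rj e1].
apply: dense_bind (h2 _ _ (fle_trans rq qp) rj) _ => v vr [l vl e2].
apply: dense_self => a av; exists l; first exact: fle_trans vl.
by apply: forces_eq_mono av _; apply: IH e2 _; exact: forces_eq_mono e1.
Qed.

Lemma forces_mem_eql x x' y p :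
  forces_eq x x' p -> forces_mem x y p -> forces_mem x' y p.
Proof.
case: y => B t d /= xx' xy r rp; have [q qr [j qj e]] := xy _ rp.
exists q => //; exists j => //; apply: forces_eq_trans e; apply: forces_eq_sym.
exact: forces_eq_mono (fle_trans qr rp) xx'.
Qed.

Lemma forces_mem_eqr y x y' p :
  forces_eq y y' p -> forces_mem x y p -> forces_mem x y' p.
Proof.
case: y y' => B t d [C u e] /= [h _] xy; apply: dense_bind xy _ => q qp [j qj e1].
apply: dense_bind (h _ _ qp qj) _ => r rq [k rk e2]; apply: dense_self => v vr.
exists k; first exact: fle_trans rk.
by apply: forces_eq_mono vr _; apply: forces_eq_trans e2; exact: forces_eq_mono e1.
Qed.

Lemma forces_mem_name A (s : A -> name P) c i p :
  fle p (c i) -> forces_mem (s i) (Name s c) p.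
Proof.
move=> pi /=; apply: dense_self => q qp; exists i; first exact: fle_trans pi.
exact: forces_eq_refl.
Qed.

Lemma forces_ext x y p :
  (forall w q, fle q p -> forces_mem w x q -> forces_mem w y q) ->
  (forall w q, fle q p -> forces_mem w y q -> forces_mem w x q) ->
  forces_eq x y p.
Proof.
case: x y => [A s c] [B t d] xy yx /=; split=> i q qp qi.
  exact: xy qp (forces_mem_name s qi).
move=> r rq; have [v vr [j vj e]] := yx _ _ qp (forces_mem_name t qi) _ rq.
by exists v => //; exists j => //; exact: forces_eq_sym.
Qed.

(** Names are well-founded: if some [q] forces [x] equal to its own member [s j], then [s j] in [x]
    becomes [s j] in [s j], against the induction hypothesis. *)
Lemma forces_mem_irrefl x p : ~ forces_mem x x p.
Proof.
elim: x p => A s IH c p h.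
have [q qp [j qj e]] := h p (fle_refl p).
apply: (IH j q); apply: forces_mem_eqr e _.
exact: forces_mem_name.
Qed.

(** * Names for unordered and ordered pairs *)

Definition npair x y : name P := Name (fun b : bool => if b then x else y) (fun=> fone P).

Definition nopair x y : name P := npair (npair x x) (npair x y).

Lemma forces_mem_npair w x y p : forces_mem w (npair x y) p <->
  dense_below p (fun r => forces_eq w x r \/ forces_eq w y r).
Proof.
split=> h q qp; have [r rq] := h _ qp.
  by move=> [[] _ e]; exists r => //; [left|right].
by move=> [] e; exists r => //; [exists true|exists false] => //; exact: fle_one.
Qed.

Lemma forces_mem_npairl x y p : forces_mem x (npair x y) p.
Proof. exact: (@forces_mem_name _ _ _ true _ (fle_one p)). Qed.

Lemma forces_mem_npairr x y p : forces_mem y (npair x y) p.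
Proof. exact: (@forces_mem_name _ _ _ false _ (fle_one p)). Qed.

Arguments forces_mem_npairl : clear implicits.
Arguments forces_mem_npairr : clear implicits.

Lemma npair_congr x y x' y' p : forces_eq x x' p -> forces_eq y y' p ->
  forces_eq (npair x y) (npair x' y') p.
Proof.
move=> ex ey; split=> -[] q qp _; apply: dense_self => r rq;
  [exists true|exists false|exists true|exists false]; (try exact: fle_one);
  exact: forces_eq_mono (fle_trans rq qp) _.
Qed.

Lemma nopair_congr x y x' y' p : forces_eq x x' p -> forces_eq y y' p ->
  forces_eq (nopair x y) (nopair x' y') p.
Proof. by move=> ex ey; apply: npair_congr; exact: npair_congr. Qed.

Lemma npair_diag x y z p : forces_eq (npair x y) (npair z z) p ->
  forces_eq x z p /\ forces_eq y z p.
Proof.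
move=> h; split; apply: forces_eq_dense.
  have /forces_mem_npair xz := forces_mem_eqr h (forces_mem_npairl x y p).
  by apply: dense_bind xz _ => q _ [] e; apply: dense_self => r rq;
     exact: forces_eq_mono e.
have /forces_mem_npair xz := forces_mem_eqr h (forces_mem_npairr x y p).
by apply: dense_bind xz _ => q _ [] e; apply: dense_self => r rq;
   exact: forces_eq_mono e.
Qed.

Lemma nopair_inj x y x' y' p : forces_eq (nopair x y) (nopair x' y') p ->
  forces_eq x x' p /\ forces_eq y y' p.
Proof.
(* Densely, [{a, b}] equals [{a'}] or [{a', b'}]; either way [b] lies in [{a', b'}]. *)
have snd a b a' b' q : forces_eq (nopair a b) (nopair a' b') q ->
    forces_mem b (npair a' b') q.
  move=> h; apply: forces_mem_dense.
  have /forces_mem_npair ab := forces_mem_eqr h (forces_mem_npairr _ (npair a b) q).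
  apply: dense_bind ab _ => r _ [] e; apply: dense_self => s sr.
    have [_ eb] := npair_diag (forces_eq_mono sr e).
    exact: forces_mem_eql (forces_eq_sym eb) (forces_mem_npairl _ _ _).
  exact: forces_mem_eqr (forces_eq_mono sr e) (forces_mem_npairr _ _ _).
move=> h.
have xx' : forces_eq x x' p.
  have /forces_mem_npair xx := forces_mem_eqr h (forces_mem_npairl (npair x x) _ p).
  apply: forces_eq_dense; apply: dense_bind xx _ => q _ [] e; apply: dense_self => r rq.
    by have [] := npair_diag (forces_eq_mono rq e).
  apply: forces_eq_sym.
  by have [] := npair_diag (forces_eq_sym (forces_eq_mono rq e)).
split=> //; have /forces_mem_npair h1 := snd _ _ _ _ _ h.
have /forces_mem_npair h2 := snd _ _ _ _ _ (forces_eq_sym h).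
(* The only case left open by the two memberships is [y = x'] and [y' = x], where [x = x'] closes
   the chain [y = x' = x = y']. *)
apply: forces_eq_dense; apply: dense_bind h1 _ => q qp {}h1.
apply: dense_bind (dense_mono qp h2) _ => r rq {}h2; apply: dense_self => s sr.
case: h1 => [yx'|]; last exact/forces_eq_mono/(fle_trans sr).
case: h2 => [y'x|/forces_eq_sym]; last exact: forces_eq_mono.
apply: forces_eq_trans (forces_eq_mono (fle_trans sr rq) yx') _.
apply: forces_eq_trans (forces_eq_sym (forces_eq_mono _ xx')) _.
  exact: fle_trans sr (fle_trans rq qp).
by apply: forces_eq_sym; exact: forces_eq_mono y'x.
Qed.

Lemma forces_upairP z x y p : forces p (is_upair z x y) <-> forces_eq z (npair x y) p.
Proof.
split=> [h|h w].
  apply: forces_ext => w q qp hw.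
    by apply/forces_mem_npair; have [h1 _] := h w; exact: h1.
  by have [_ h2] := h w; apply: h2 => //; apply/forces_mem_npair.
split=> q qp hw.
  by apply/forces_mem_npair; exact: forces_mem_eqr (forces_eq_mono qp h) hw.
apply: forces_mem_eqr (forces_eq_sym (forces_eq_mono qp h)) _.
exact/forces_mem_npair.
Qed.

Lemma forces_opairP z x y p : forces p (is_opair z x y) <-> forces_eq z (nopair x y) p.
Proof.
have upP w q : dense_below q (fun r => forces_eq w (npair x x) r \/ forces_eq w (npair x y) r)
    <-> dense_below q (fun r => forces r (is_upair w x x) \/ forces r (is_upair w x y)).
  split=> h; apply: dense_bind h _ => r _ h; apply: dense_self => s sr.
    by case: h => e; [left|right]; apply/forces_upairP; exact: forces_eq_mono e.
  by case: h => /forces_upairP e; [left|right]; exact: forces_eq_mono e.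
split=> [h|h w].
  apply: forces_ext => w q qp hw.
    by apply/forces_mem_npair/upP; have [h1 _] := h w; exact: h1.
  by have [_ h2] := h w; apply: h2 => //; apply/upP/forces_mem_npair.
split=> q qp hw.
  by apply/upP/forces_mem_npair; exact: forces_mem_eqr (forces_eq_mono qp h) hw.
apply: forces_mem_eqr (forces_eq_sym (forces_eq_mono qp h)) _.
exact/forces_mem_npair/upP.
Qed.

(** * Check names of pairs, natural numbers and reals *)

Lemma check_vopair a b p :
  forces_eq (check P (vopair a b)) (nopair (check P a) (check P b)) p.
Proof.
have up c d q : forces_eq (check P (vupair c d)) (npair (check P c) (check P d)) q.
  by split=> -[] r rq _; apply: dense_self => s sr;
    [exists true|exists false|exists true|exists false]; (try exact: fle_one);
    exact: forces_eq_refl.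
apply: forces_eq_trans (up _ _ _) _; exact: npair_congr (up _ _ _) (up _ _ _).
Qed.

Lemma forces_mem_check A (s : A -> vset) i p :
  forces_mem (check P (s i)) (check P (VSet s)) p.
Proof.
exact: (@forces_mem_name _ (fun i => check P (s i)) (fun=> fone P) _ _ (fle_one p)).
Qed.

Lemma forces_mem_check_dense A (s : A -> vset) x p :
  forces_mem x (check P (VSet s)) p ->
  dense_below p (fun r => exists i, forces_eq x (check P (s i)) r).
Proof. by move=> h q qp; have [r rq [i _ e]] := h _ qp; exists r => //; exists i. Qed.

Lemma check_vnat_mem m n p : (m < n)%N ->
  forces_mem (check P (vnat m)) (check P (vnat n)) p.
Proof.
have self a : forces_mem (check P a) (check P (vsucc a)) p.
  case: a => A s.
  exact: (@forces_mem_check _ (fun o : option A => if o is Some i then s i else VSet s) None).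
have up x a : forces_mem x (check P a) p -> forces_mem x (check P (vsucc a)) p.
  case: a => A s h q qp; have [r rq [i ri e]] := h _ qp.
  by exists r => //; exists (Some i).
elim: n => // n IH; rewrite ltnS leq_eqVlt => /predU1P[->|/IH]; first exact: self.
exact: up.
Qed.

Lemma check_vnat_inj m n p :
  forces_eq (check P (vnat m)) (check P (vnat n)) p -> m = n.
Proof.
move=> e; case: (ltngtP m n) => // lt.
  exact: False_ind (forces_mem_irrefl
    (forces_mem_eqr (forces_eq_sym e) (check_vnat_mem p lt))).
exact: False_ind (forces_mem_irrefl (forces_mem_eqr e (check_vnat_mem p lt))).
Qed.

(** Some extension decides which pair [(m, g m)] the member [(n, f n)] equals; equality of check
    names of naturals is genuine equality, so [m = n] and [f n = g n]. *)
Lemma check_vreal_inj f g p :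
  forces_eq (check P (vreal f)) (check P (vreal g)) p -> f = g.
Proof.
move=> e; apply/funext => n.
have h := forces_mem_eqr e (@forces_mem_check _ (fun n => vopair (vnat n) (vnat (f n))) n p).
have [q _ [m e1]] := forces_mem_check_dense h (fle_refl p).
have : forces_eq (nopair (check P (vnat n)) (check P (vnat (f n))))
                 (nopair (check P (vnat m)) (check P (vnat (g m)))) q.
  apply: forces_eq_trans (forces_eq_sym (check_vopair _ _ _)) _.
  exact: forces_eq_trans e1 (check_vopair _ _ _).
by move=> /nopair_inj[/check_vnat_inj -> /check_vnat_inj].
Qed.

(* The name [{((rho, n), q) | D rho n q}] is forced to be an injection of the
   ground model reals into [omega]. *)
Lemma forces_countable_reals p (D : baire -> nat -> P -> Prop) :
  (forall f n q r, fle r q -> D f n q -> D f n r) ->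
  (forall f m n q, D f m q -> D f n q -> m = n) ->
  (forall f g n q, D f n q -> D g n q -> f = g) ->
  (forall f q, fle q p -> exists2 r, fle r q & exists n, D f n r) ->
  forces p (is_countable (check P vomega) (check P vreals)).
Proof.
move=> Dmono Dfun Dinj Ddense.
pose I := {i : (baire * nat) * P | D i.1.1 i.1.2 i.2}.
pose F := Name (fun i : I => check P (vopair (vreal (sval i).1.1) (vnat (sval i).1.2)))
               (fun i : I => (sval i).2).
have memF z q : forces_mem z F q -> dense_below q (fun r => exists f n,
    D f n r /\ forces_eq z (nopair (check P (vreal f)) (check P (vnat n))) r).
  move=> h r rq; have [s sr [[[[f n] t] /= Dt] st e]] := h _ rq.
  exists s => //; exists f, n; split; first exact: Dmono Dt.
  exact: forces_eq_trans e (check_vopair _ _ _).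
have pairF x y q : forces q (pair_in x y F) -> dense_below q (fun r => exists f n,
    [/\ D f n r, forces_eq x (check P (vreal f)) r & forces_eq y (check P (vnat n)) r]).
  move=> h; apply: dense_bind h _ => r _ [z [/memF zF /forces_opairP zxy]].
  apply: dense_bind zF _ => s sr [f [n [Ds e]]]; apply: dense_self => t ts.
  have /nopair_inj[e1 e2] := forces_eq_trans
    (forces_eq_sym (forces_eq_mono (fle_trans ts sr) zxy)) (forces_eq_mono ts e).
  by exists f, n; split=> //; exact: Dmono Ds.
apply: dense_self => q qp; exists F; split; [split; [|split]|].
- move=> z r rq /memF zF; apply: dense_bind zF _ => s sr [f [n [_ e]]].
  apply: dense_self => t ts; exists (check P (vreal f)).
  split; first exact: (@forces_mem_check _ vreal).
  apply: dense_self => u ut; exists (check P (vnat n)).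
  split; first exact: (@forces_mem_check _ vnat).
  by apply/forces_opairP; apply: forces_eq_mono e; exact: fle_trans ts.
(* Totality: once [x] is decided to be the real [f], [Ddense] supplies a condition deciding its
   value. *)
- move=> x r rq /forces_mem_check_dense xr; apply: dense_bind xr _ => s sr [f e].
  move=> t ts; have [u ut [n Du]] := Ddense f t (fle_trans ts (fle_trans sr (fle_trans rq qp))).
  exists u => //; exists (check P (vnat n)); split; first exact: (@forces_mem_check _ vnat).
  apply: dense_self => v vu; exists (check P (vopair (vreal f) (vnat n))); split.
    exact: (@forces_mem_name _ _ _ (exist _ (f, n, u) Du : I)).
  apply/forces_opairP; apply: forces_eq_trans (check_vopair _ _ _) _.
  apply: nopair_congr (forces_eq_refl _ _); apply: forces_eq_sym.
  by apply: forces_eq_mono e; exact: fle_trans vu (fle_trans ut ts).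
(* Functionality: at a common extension both pairs come from [D], with reals forced equal and hence
   equal, so [Dfun] applies. Injectivity exchanges the coordinates and uses [Dinj]. *)
- move=> x y y' r rq [/pairF h /pairF h']; apply: forces_eq_dense.
  apply: dense_bind h _ => s sr [f [n [D1 x1 y1]]].
  apply: dense_bind (dense_mono sr h') _ => t ts [f' [n' [D2 x2 y2]]].
  have ff' : f = f'.
    exact: check_vreal_inj (forces_eq_trans (forces_eq_sym (forces_eq_mono ts x1)) x2).
  move: D2 y2; rewrite -ff' => /(Dfun _ _ _ _ (Dmono _ _ _ _ ts D1)) <- y2.
  apply: dense_self => u ut; apply: forces_eq_mono ut _.
  exact: forces_eq_trans (forces_eq_mono ts y1) (forces_eq_sym y2).
- move=> x x' y r rq [/pairF h /pairF h']; apply: forces_eq_dense.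
  apply: dense_bind h _ => s sr [f [n [D1 x1 y1]]].
  apply: dense_bind (dense_mono sr h') _ => t ts [f' [n' [D2 x2 y2]]].
  have nn' : n = n'.
    exact: check_vnat_inj (forces_eq_trans (forces_eq_sym (forces_eq_mono ts y1)) y2).
  move: D2 x2; rewrite -nn' => /(Dinj _ _ _ _ (Dmono _ _ _ _ ts D1)) <- x2.
  apply: dense_self => u ut; apply: forces_eq_mono ut _.
  exact: forces_eq_trans (forces_eq_mono ts x1) (forces_eq_sym x2).
Qed.

End ForcingRelation.

(** * Binary trees of bounded width *)

Lemma take_mkseq_le T (x : nat -> T) a b : (a <= b)%N -> take a (mkseq x b) = mkseq x a.
Proof. by move=> ab; rewrite /mkseq -map_take take_iota; congr map; congr iota; lia. Qed.

Lemma koenig (Q : seq bool -> Prop) :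
  (forall s n, Q s -> Q (take n s)) -> (forall n, exists2 s, size s = n & Q s) ->
  exists x : nat -> bool, forall n, Q (mkseq x n).
Proof.
move=> Qtake Qsize; pose alive s := forall n, exists2 t, size t = n & Q (s ++ t).
have /choice[f fP] : forall s, exists b, alive s -> alive (rcons s b).
  move=> s.
  have [at1|/existsNP[n1 d1]] := pselect (alive (rcons s true)); first by exists true.
  have [at0|/existsNP[n0 d0]] := pselect (alive (rcons s false)); first by exists false.
  (* Both children are dead, failing at lengths [n1] and [n0]. An extension of [s] by [n0 + n1 + 1]
     bits passes through one child and, truncated, contradicts that child's failure; so [s] is not
     alive and the value [true] is arbitrary. *)
  exists true => /(_ (n0 + n1).+1)[[//|b t] [szt] Qt]; exfalso.
  have short n : (n <= size t)%N -> exists2 t', size t' = n & Q (rcons s b ++ t').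
    move=> nt; exists (take n t); first by rewrite size_take_min; lia.
    rewrite cat_rcons; have := Qtake _ (size s + n.+1)%N Qt.
    by rewrite take_cat ltnNge leq_addr /= addKn.
  case: b short {Qt} => short; [apply: d1 | apply: d0]; apply: short; lia.
pose w := fix w n := if n is k.+1 then rcons (w k) (f (w k)) else [::].
have aw n : alive (w n).
  by elim: n => [|n IH] /=; [move=> n; have [s] := Qsize n; exists s | exact: fP].
exists (f \o w) => n; have -> : mkseq (f \o w) n = w n.
  by elim: n => // n; rewrite mkseqS => ->.
by have [[|//] _] := aw n 0%N; rewrite cats0.
Qed.

Definition is_branch (F : seq bool -> Prop) m s :=
  forall l, (m <= l <= size s)%N -> F (take l s).

(* The first [a] bits determine an infinite branch of [F] above level [m];
   stated through finite approximations to keep it arithmetical in [F]. *)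
Definition rigid (F : seq bool -> Prop) m a := forall b, exists2 c, (b <= c)%N &
  forall s t, size s = c -> size t = c -> is_branch F m s -> is_branch F m t ->
    take a s = take a t -> take b s = take b t.

Lemma take_eq_le T (s t : seq T) a b :
  (a <= b)%N -> take b s = take b t -> take a s = take a t.
Proof. by move=> ab e; rewrite -(take_takel s ab) e take_takel. Qed.

Lemma rigid_le F m a b : (a <= b)%N -> rigid F m a -> rigid F m b.
Proof.
move=> ab Fa n; have [c nc h] := Fa n; exists c => // s t ss st bs bt e.
by apply: h => //; exact: take_eq_le e.
Qed.

Lemma rigid_branch_inj F m a (x z : nat -> bool) : rigid F m a ->
  (forall l, (m <= l)%N -> F (mkseq x l)) -> (forall l, (m <= l)%N -> F (mkseq z l)) ->
  mkseq x a = mkseq z a -> x = z.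
Proof.
(* The bound [n.+1] makes bit [n] visible; the bound [a] ensures that the approximations of length
   [c] contain the determining bits. *)
move=> Fa Fx Fz xz; apply/funext => n; have [c nc h] := Fa (maxn a n.+1).
have br y : (forall l, (m <= l)%N -> F (mkseq y l)) -> is_branch F m (mkseq y c).
  by move=> Fy l; rewrite size_mkseq => /andP[ml lc]; rewrite take_mkseq_le //; exact: Fy.
have := h _ _ (size_mkseq x c) (size_mkseq z c) (br _ Fx) (br _ Fz).
rewrite !take_mkseq_le; try lia; move=> /(_ xz) /(congr1 (nth false ^~ n)).
by rewrite !nth_mkseq //; lia.
Qed.

Lemma separating_level (u : seq (nat -> bool)) :
  exists a, forall b, (a <= b)%N -> {in u &, injective (fun x => mkseq x b)}.
Proof.
have /choice[d dP] : forall p : (nat -> bool) * (nat -> bool),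
    exists n, p.1 <> p.2 -> p.1 n <> p.2 n.
  move=> p.
  have [e|ne] := pselect (p.1 = p.2); first by exists 0%N.
  apply: contrapT => /forallNP h; apply: ne; apply/funext => n.
  by apply: contrapT => ne; apply: (h n).
exists (\max_(x <- u) \max_(z <- u) d (x, z)).+1 => b ab x z xu zu e.
apply: contrapT => /(dP (x, z)) /=; apply.
have lt : (d (x, z) < b)%N.
  apply: leq_trans ab; rewrite ltnS.
  have := @leq_bigmax_seq _ u predT (fun x => \max_(z <- u) d (x, z)) x xu isT.
  by apply: leq_trans; exact: (@leq_bigmax_seq _ u predT (fun z => d (x, z))).
by have := congr1 (nth false ^~ (d (x, z))) e; rewrite !nth_mkseq.
Qed.

(* A tree of bounded width has finitely many infinite branches, and by
   compactness its long finite branches follow these. *)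
Lemma bounded_width_rigid (F : seq bool -> Prop) N :
  (forall n u, uniq u -> (forall s, s \in u -> size s = n /\ F s) -> (size u <= N)%N) ->
  exists a, forall m, rigid F m a.
Proof.
move=> width; pose R (x : nat -> bool) := exists m, forall l, (m <= l)%N -> F (mkseq x l).
(* At a level beyond all starting levels and separating the branches in [u], their initial segments
   are distinct nodes of [F]. *)
have boundR u : uniq u -> (forall x, x \in u -> R x) -> (size u <= N)%N.
  move=> uu Ru; have [a sep] := separating_level u.
  have /choice[e eP] : forall x, exists m, x \in u -> forall l, (m <= l)%N -> F (mkseq x l).
    by move=> x; have [/Ru[m]|] := pselect (x \in u); [exists m | exists 0%N].
  pose b := maxn a (\max_(x <- u) e x).
  rewrite -(size_map (fun x => mkseq x b)); apply: (width b).
    by rewrite map_inj_in_uniq //; apply: sep; exact: leq_maxl.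
  move=> _ /mapP[x xu ->]; rewrite size_mkseq; split=> //; apply: eP => //.
  by apply: leq_trans (leq_maxr _ _); exact: (@leq_bigmax_seq _ u predT e).
(* A list of infinite branches of maximal length contains them all. *)
pose M n := `[< exists u, [/\ uniq u, size u = n & forall x, x \in u -> R x] >].
have exM : exists n, M n by exists 0%N; apply/asboolP; exists [::].
have leM n : M n -> (n <= N)%N by move=> /asboolP[u [uu <- Ru]]; exact: boundR.
case: (ex_maxnP exM leM) => _ /asboolP[u [uu <- Ru]] maxu.
have uR x : R x -> x \in u.
  move=> Rx; apply: contrapT => /negP xu; suff /maxu : M (size u).+1 by rewrite ltnn.
  apply/asboolP; exists (x :: u); split=> [|//|z]; first by rewrite /= xu.
  by rewrite inE => /predU1P[->|/Ru].
have [a sep] := separating_level u.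
exists a => m b; pose b' := maxn a b.
have [c b'c hc] : exists2 c, (b' <= c)%N & forall s, size s = c -> is_branch F m s ->
    exists2 x, x \in u & take b' s = mkseq x b'.
  apply: contrapT => nc.
  (* If no [c] works, finite branches straying from [u] within [b'] bits exist at all large lengths,
     and [koenig] yields an infinite branch outside [u]. The guard on the length keeps [Q] closed
     under initial segments. *)
  pose Q s := is_branch F m s /\
    ((b' <= size s)%N -> forall x, x \in u -> take b' s <> mkseq x b').
  have Qtake s n : Q s -> Q (take n s).
    move=> [bs sx]; have [ns|sn] := leqP n (size s); last by rewrite take_oversize // ltnW.
    split=> [l|]; rewrite size_takel // => h.
      by rewrite take_takel; [apply: bs|]; lia.
    by move=> x xu; rewrite take_takel //; apply: sx => //; lia.
  have [n|x Qx] := koenig Qtake.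
    have [s ss Qs] : exists2 s, size s = maxn n b' & Q s.
      apply: contrapT => ns; apply: nc; exists (maxn n b'); first exact: leq_maxr.
      move=> s ss bs; apply: contrapT => nx; apply: ns; exists s => //; split=> // _ x xu e.
      by apply: nx; exists x.
    by exists (take n s); [rewrite size_takel // ss leq_maxl | exact: Qtake].
  have xu : x \in u.
    apply: uR; exists m => l ml; have [h _] := Qx l.
    by have := h l; rewrite size_mkseq take_mkseq_le // leqnn ml; exact.
  have [_] := Qx b'; rewrite size_mkseq take_mkseq_le // => /(_ (leqnn _) x xu).
  exact.
exists c => [|s t ss st bs bt e]; first by rewrite (leq_trans _ b'c) // leq_maxr.
have [x xu sx] := hc s ss bs; have [z zu tz] := hc t st bt.
have xz : x = z.
  apply: (sep a) => //; rewrite -(@take_mkseq_le _ x a b') ?leq_maxl //.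
  by rewrite -(@take_mkseq_le _ z a b') ?leq_maxl // -sx -tz !take_takel ?leq_maxl.
apply: (@take_eq_le _ _ _ b b'); first exact: leq_maxr.
by rewrite sx xz.
Qed.

(** * The condition *)

(* A real [y : baire] is read as a sequence of guesses: [y i] guesses a binary
   sequence of length [level i]; every length is guessed infinitely often. *)
Definition level i := logn 2 i.

Lemma level_unbounded l N : exists2 i, (N <= i)%N & level i = l.
Proof.
(* The odd factor leaves the 2-adic valuation at [l] and makes the product at least [N]. *)
exists (2 ^ l * N.*2.+1)%N.
  by rewrite (leq_trans _ (leq_pmull _ _)) ?expn_gt0 //; lia.
by rewrite /level lognM ?expn_gt0 // pfactorK // lognE /= dvdn2 /= odd_double /= addn0.
Qed.

Lemma level_le i : (level i <= i)%N.
Proof.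
case: i => // i; rewrite /level; apply: ltnW; apply: (@ltn_logl 2 i.+1).
by [].
Qed.

Definition unguessed (y : baire) (s : seq bool) :=
  forall i, level i = size s -> y i <> pickle s.

Definition thin (y : baire) := forall m, exists a, rigid (unguessed y) m a.

Lemma pickle_bounded n : exists N, forall s : seq bool, (size s < n)%N -> (pickle s < N)%N.
Proof.
exists (\max_(k < n) \max_(t : k.-tuple bool) pickle (tval t)).+1 => s sn; rewrite ltnS.
have := leq_bigmax (F := fun k : 'I_n => \max_(t : k.-tuple bool) pickle (tval t)) (Ordinal sn).
apply: leq_trans.
exact: (leq_bigmax (F := fun t : (size s).-tuple bool => pickle (tval t)) (in_tuple s)).
Qed.

Lemma countable_range (C : set baire) :
  countable C -> exists c : nat -> baire, forall x, C x -> exists k, c k = x.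
Proof.
move=> /countable_injP[f finj].
exists (fun k => xget (cst 0%N) [set x | C x /\ f x = k]) => x Cx; exists (f x).
case: xgetP => [y -> [Cy fy]|/(_ x)]; last by case.
by apply: finj; rewrite ?inE.
Qed.

(** The sequences that cannot be guessed arbitrarily late without agreeing with one of [c 0], ...,
    [c k] at that place. *)
Definition captured (c : nat -> baire) k (s : seq bool) := exists N, forall i,
  (N <= i)%N -> level i = size s -> exists2 j, (j <= k)%N & c j i = pickle s.

(** Pigeonhole at a single late place [i] of level [n]: the distinct codes of the captured sequences
    all occur among [c 0 i], ..., [c k i]. *)
Lemma captured_width c k n (u : seq (seq bool)) : uniq u ->
  (forall s, s \in u -> size s = n /\ captured c k s) -> (size u <= k.+1)%N.
Proof.
move=> uu cu.
have /choice[N NP] : forall s, exists N, s \in u -> forall i,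
    (N <= i)%N -> level i = n -> exists2 j, (j <= k)%N & c j i = pickle s.
  move=> s; have [/cu[<- [N h]]|] := pselect (s \in u); first by exists N.
  by exists 0%N.
have [i Ni li] := level_unbounded n (\max_(s <- u) N s).
rewrite -(size_map pickle) -(size_iota 0 k.+1) -(size_map (fun j => c j i) (iota 0 k.+1)).
apply: uniq_leq_size; first by rewrite map_inj_uniq //; exact: (pcan_inj pickleK).
move=> _ /mapP[s su ->]; have Nsi : (N s <= i)%N := leq_trans (@leq_bigmax_seq _ u predT N s su isT) Ni.
by have [j jk <-] := NP s su i Nsi li; rewrite map_f // mem_iota.
Qed.

Lemma stageP (l : nat -> nat) : l 0%N = 0%N -> (forall k, (l k < l k.+1)%N) ->
  forall n, exists k, (l k <= n < l k.+1)%N.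
Proof.
move=> l0 linc; elim=> [|n [k /andP[kn nk]]]; first by exists 0%N; have := linc 0%N; rewrite l0.
have [lt|ge] := ltnP n.+1 (l k.+1); first by exists k; rewrite lt (leq_trans kn).
by exists k.+1; rewrite ge; have := linc k.+1; lia.
Qed.

Lemma thin_dominating : omega_dominating [set y | thin y].
Proof.
move=> C /countable_range[c cP]; pose F := captured c.
(* Asking for [k <= a k] makes agreement on [a K] bits, for large [K], cover any given number of
   bits. *)
have /choice[a aP] : forall k, exists a, (k <= a)%N /\ forall m, rigid (F k) m a.
  move=> k; have [a ra] := bounded_width_rigid (@captured_width c k).
  by exists (maxn k a); split=> [|m]; [exact: leq_maxl | apply: rigid_le (ra m); exact: leq_maxr].
have /choice[h hP] : forall x : nat * nat, exists e, (a x.1.+1 <= e)%N /\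
    forall s t, size s = e -> size t = e -> is_branch (F x.1) x.2 s -> is_branch (F x.1) x.2 t ->
    take (a x.1) s = take (a x.1) t -> take (a x.1.+1) s = take (a x.1.+1) t.
  by move=> [k m]; have [e le eP] := (aP k).2 m (a k.+1); exists e.
(* Stage [k] handles the lengths from [l k] to below [l k.+1]. It includes the length [h (k, l k)],
   at which agreement on [a k] bits of branches of [F k] above [l k] yields agreement on [a k.+1]
   bits. *)
pose l := fix l k := if k is j.+1 then (maxn (l j) (h (j, l j))).+1 else 0%N.
have linc k : (l k < l k.+1)%N by rewrite /= ltnS leq_maxl.
have lmono j k : (j <= k)%N -> (l j <= l k)%N.
  elim: k => [|k IH]; first by rewrite leqn0 => /eqP->.
  rewrite leq_eqVlt => /predU1P[->//|]; rewrite ltnS => /IH jk.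
  exact: leq_trans jk (ltnW (linc k)).
have lge k : (k <= l k)%N by elim: k => // k IH; exact: leq_ltn_trans IH _.
have /choice[st stP] := stageP (erefl : l 0%N = 0%N) linc.
have stE k n : (l k <= n < l k.+1)%N -> st n = k.
  move=> /andP[kn nk]; have /andP[sn ns] := stP n; apply/eqP; rewrite eqn_leq.
  by apply/andP; split; rewrite leqNgt; apply/negP => /lmono; lia.
pose target n (s : seq bool) := pickle s = n /\ ~ F (st (size s)) s.
(* The targets are the codes of sequences not captured at their stage; [g (n, N)] is a place from
   [N] on where guessing the target [n] avoids the reals of that stage. *)
have /choice[g gP] : forall x : nat * nat, exists i, (x.2 <= i)%N /\ forall s, target x.1 s ->
    level i = size s /\ forall j, (j <= st (size s))%N -> c j i <> x.1.
  move=> [n N] /=.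
  have [[s [<- sF]]|no] := pselect (exists s, target n s); last first.
    by exists N; split=> // s ts; case: no; exists s.
  move/forallNP/(_ N)/existsNP: (sF) => [i /not_implyP[Ni /not_implyP[li nc]]].
  exists i; split=> // s' [/(pcan_inj pickleK) -> _]; split=> // j js e.
  by apply: nc; exists j.
pose pos := fix pos n := if n is k.+1 then g (n, (pos k).+1) else g (0%N, 0%N).
have posP n s : target n s -> level (pos n) = size s /\
    forall j, (j <= st (size s))%N -> c j (pos n) <> n.
  by case: n => [|n]; [exact: (gP (0, 0)%N).2 | exact: (gP (n.+1, (pos n).+1)).2].
have pos_inc n : (pos n < pos n.+1)%N by exact: (gP (n.+1, (pos n).+1)).1.
have pos_mono j k : (j < k)%N -> (pos j < pos k)%N.
  elim: k => // k IH; rewrite ltnS leq_eqVlt => /predU1P[->//|/IH jk].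
  exact: ltn_trans jk _.
have pos_inj j k : pos j = pos k -> j = k.
  by move=> e; case: (ltngtP j k) => // /pos_mono; rewrite e ltnn.
(* Each target is guessed at its own place; any other place [i] gets a value above [c 0 i], ...,
   [c i i]. *)
have /choice[y yP] : forall i, exists v,
    (forall n s, pos n = i -> target n s -> v = n) /\
    ((forall n s, pos n = i -> ~ target n s) -> v = (\sum_(j < i.+1) c j i).+1).
  move=> i; have [[n [s [pn ts]]]|no] := pselect (exists n s, pos n = i /\ target n s).
    exists n; split=> [n' s' pn' _|/(_ _ _ pn ts)//].
    by apply: pos_inj; rewrite pn pn'.
  exists (\sum_(j < i.+1) c j i).+1; split=> // n s pn ts.
  by case: no; exists n, s.
have unguessedF s : unguessed y s -> F (st (size s)) s.
  move=> ug; apply: contrapT => nF.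
  have ts : target (pickle s) s by [].
  have [lp _] := posP _ _ ts; apply: (ug _ lp).
  exact: (yP (pos (pickle s))).1 ts.
exists y => [m|x /cP[k <-]].
  (* Thinness: agreement on [a m] bits is propagated through the stages [m], ..., [K - 1] to
     agreement on [a K] bits, and [b <= K <= a K]. *)
  exists (a m) => b; pose K := maxn m b.
  exists (maxn b (l K)); first exact: leq_maxl.
  move=> s t ss st' bs bt e.
  suff: take (a K) s = take (a K) t.
    by apply: take_eq_le; apply: leq_trans (aP K).1; exact: leq_maxr.
  have : (l K <= size s)%N by rewrite ss leq_maxr.
  have : (m <= K)%N by exact: leq_maxl.
  have sst : size t = size s by rewrite ss.
  move: K {ss st'} => K; elim: K => [|K IH]; first by rewrite leqn0 => /eqP<-.
  rewrite leq_eqVlt => /predU1P[<-//|mK] lK.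
  pose H := h (K, l K).
  have lH : (maxn (l K) H < l K.+1)%N by [].
  have Hs : (H <= size s)%N by lia.
  (* Lengths between [l K] and [H] belong to stage [K], where unguessed sequences are captured by
     [F K]; the bounds [m <= K <= l K] put them above level [m]. *)
  have br u : size u = size s -> is_branch (unguessed y) m u -> is_branch (F K) (l K) (take H u).
    move=> su bu i; rewrite size_takel ?su // => /andP[Ki iH].
    rewrite take_takel //.
    have si : size (take i u) = i by rewrite size_takel // su; lia.
    have := @unguessedF (take i u); rewrite si (stE K); last by lia.
    by apply; apply: bu; have := lge K; lia.
  have [aH hH] := hP (K, l K).
  have /IH {}IH : (m <= K)%N by [].
  have := hH (take H s) (take H t).
  rewrite !size_takel ?sst // => /(_ erefl erefl (br _ erefl bs) (br _ sst bt)).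
  rewrite !(take_takel _ aH); apply.
  by rewrite -!take_min ![minn _ H]minnC !take_min IH //; have := linc K; lia.
(* Only targets of stages before [k] may agree with [c k]. They are shorter than [l k], so their
   codes are below [B] and their places are bounded. From [i = k] on, the default value exceeds
   [c k i]. *)
have [B BP] := pickle_bounded (l k).
exists (maxn k (\max_(n < B) (pos n).+1)) => //= i.
rewrite /= geq_max => /andP[ki Bi] e.
have [[n [s [pn ts]]]|no] := pselect (exists n s, pos n = i /\ target n s).
  have yn := (yP i).1 _ _ pn ts; have [_ av] := posP _ _ ts.
  have [kst|stk] := leqP k (st (size s)).
    by apply: (av k kst); rewrite pn e.
  have sl : (size s < l k)%N.
    by have /andP[_] := stP (size s); move/leq_trans; apply; exact: lmono.
  have nB : (n < B)%N by rewrite -ts.1; exact: BP.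
  have := leq_bigmax (F := fun n : 'I_B => (pos n).+1) (Ordinal nB).
  by rewrite /= pn; lia.
have ks : (c k i <= \sum_(j < i.+1) c j i)%N.
  have ki' : (k < i.+1)%N by rewrite ltnS.
  by rewrite (bigD1 (Ordinal ki')) //= leq_addr.
have yi : y i = (\sum_(j < i.+1) c j i).+1.
  by apply: (yP i).2 => n s pn ts; apply: no; exists n, s.
by move: ks; rewrite e yi ltnn.
Qed.

(** * Labels *)

Lemma borelC (A : set baire) : borel A -> borel (~` A).
Proof.
rewrite -setTD; have [_ h _] := smallest_sigma_algebra [set: baire] [set U | open U].
exact: h.
Qed.

Lemma borel_bigcup (A : nat -> set baire) : (forall n, borel (A n)) -> borel (\bigcup_n A n).
Proof.
have [_ _ h] := smallest_sigma_algebra [set: baire] [set U | open U].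
exact: h.
Qed.

Lemma borel_not (A : baire -> Prop) : borel [set y | A y] -> borel [set y | ~ A y].
Proof. exact: borelC. Qed.

Lemma borel_cst (A : Prop) : borel [set _ | A].
Proof.
have [a|na] := pselect A.
  have -> : [set _ : baire | A] = setT by apply/seteqP; split.
  exact: borelT.
have -> : [set _ : baire | A] = ~` setT by apply/seteqP; split=> y //=; apply.
exact: borelC borelT.
Qed.

Lemma borel_exists (T : countType) (A : T -> baire -> Prop) :
  (forall t, borel [set y | A t y]) -> borel [set y | exists t, A t y].
Proof.
move=> bA; have -> : [set y | exists t, A t y] = \bigcup_n
    [set y | if unpickle n is Some t then A t y else False].
  apply/seteqP; split=> y /= [t]; first by exists (pickle t); rewrite //= pickleK.
  by move=> _ /=; case: unpickle => // s; exists s.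
apply: borel_bigcup => n; case: unpickle => [t|]; first exact: bA.
exact: borel_cst.
Qed.

Lemma borel_forall (T : countType) (A : T -> baire -> Prop) :
  (forall t, borel [set y | A t y]) -> borel [set y | forall t, A t y].
Proof.
move=> bA; have -> : [set y | forall t, A t y] = [set y | ~ exists t, ~ A t y].
  by apply/seteqP; split=> y /= => [h [t]|/forallNP h t]; [apply | exact: contrapT].
by apply: borel_not; apply: borel_exists => t; exact: borel_not.
Qed.

Lemma borel_or (A B : baire -> Prop) : borel [set y | A y] -> borel [set y | B y] ->
  borel [set y | A y \/ B y].
Proof.
move=> bA bB; have -> : [set y | A y \/ B y] =
    [set y | exists b : bool, (if b then A else B) y].
  apply/seteqP; split=> y /=; first by case=> h; [exists true|exists false].
  by case=> -[] h; [left|right].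
by apply: borel_exists => -[].
Qed.

Lemma borel_imply (A B : baire -> Prop) : borel [set y | A y] -> borel [set y | B y] ->
  borel [set y | A y -> B y].
Proof.
move=> bA bB; have -> : [set y | A y -> B y] = [set y | ~ A y \/ B y].
  by apply/funext => y; exact: implyE.
by apply: borel_or => //; exact: borel_not.
Qed.

Lemma borel_and (A B : baire -> Prop) : borel [set y | A y] -> borel [set y | B y] ->
  borel [set y | A y /\ B y].
Proof.
move=> bA bB; have -> : [set y | A y /\ B y] =
    [set y | forall b : bool, (if b then A else B) y].
  apply/seteqP; split=> y /=; first by case=> a b [].
  by move=> h; split; [exact: (h true)|exact: (h false)].
by apply: borel_forall => -[].
Qed.

Lemma borel_coord i (v : nat) : borel [set y : baire | y i = v].
Proof.
apply: sub_sigma_algebra => /=.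
have -> : [set y : baire | y i = v] = (fun y : baire => y i) @^-1` [set v] by [].
apply: open_comp; last exact: discrete_open.
by move=> y _; exact: (@proj_continuous nat (fun=> nat) i y).
Qed.

Lemma borel_unguessed s : borel [set y | unguessed y s].
Proof.
apply: borel_forall => i; apply: borel_imply; first exact: borel_cst.
exact: borel_not (borel_coord _ _).
Qed.

Lemma borel_rigid m a : borel [set y | rigid (unguessed y) m a].
Proof.
apply: borel_forall => b.
have -> : [set y | exists2 c, (b <= c)%N & forall s t, size s = c -> size t = c ->
      is_branch (unguessed y) m s -> is_branch (unguessed y) m t ->
      take a s = take a t -> take b s = take b t] =
    [set y | exists c, (b <= c)%N /\ forall s t, size s = c -> size t = c ->
      is_branch (unguessed y) m s -> is_branch (unguessed y) m t ->
      take a s = take a t -> take b s = take b t].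
  by apply/seteqP; split=> y /= [c]; [exists c | case; exists c].
have br s : borel [set y | is_branch (unguessed y) m s].
  apply: borel_forall => l; apply: borel_imply (borel_unguessed _); exact: borel_cst.
apply: borel_exists => c; apply: borel_and; first exact: borel_cst.
apply: borel_forall => s; apply: borel_forall => t.
by do 2![apply: borel_imply; first exact: borel_cst]; do 2![apply: borel_imply => //];
   exact: borel_cst.
Qed.

Lemma borel_thin : borel [set y | thin y].
Proof.
by apply: borel_forall => m; apply: borel_exists => a; exact: borel_rigid.
Qed.

(** The characteristic function of the graph of [f], read along codes of pairs. *)
Definition bits (f : baire) (k : nat) : bool :=
  if unpickle k is Some (i, j) then f i == j else false.

Lemma bits_inj : injective bits.
Proof.
move=> f g fg; apply/funext => i.
have := congr1 (fun x => x (pickle (i, g i))) fg.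
by rewrite /bits pickleK eqxx => /eqP.
Qed.

(* [n] codes a pair [(m, s)] such that [bits f] is the only infinite branch of
   [unguessed y] above level [m] extending [s]. *)
Definition label (y : baire) (f : baire) (n : nat) :=
  if unpickle n is Some (m, s) then
    [/\ rigid (unguessed y) m (size s), forall l, (m <= l)%N -> unguessed y (mkseq (bits f) l)
      & s = mkseq (bits f) (size s)]
  else False.

(** Several labels may fit the same [f]; the least one makes the name single-valued. *)
Definition first_label (y f : baire) n :=
  label y f n /\ forall k, (k < n)%N -> ~ label y f k.

Lemma label_inj y f g n : label y f n -> label y g n -> f = g.
Proof.
rewrite /label; case: unpickle => // -[m s] [rs bf sf] [_ bg sg].
by apply: bits_inj; apply: rigid_branch_inj rs bf bg _; rewrite -sf -sg.
Qed.

Lemma first_label_fun y f m n : first_label y f m -> first_label y f n -> m = n.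
Proof. by move=> [fm mm] [fn mn]; case: (ltngtP m n) => // [/mn|/mm]. Qed.

(** If [y] differs from the guesses of [bits f] from [N] on, no initial segment of length [l >= N]
    is guessed, since places of level [l] are at least [l]. Thinness at [N] supplies the bits of the
    label. *)
Lemma label_exists y f : thin y -> ev_diff (fun i => pickle (mkseq (bits f) (level i))) y ->
  exists n, first_label y f n.
Proof.
move=> yt [N _ dN]; have [a ra] := yt N.
have : exists n, `[< label y f n >].
  exists (pickle (N, mkseq (bits f) a)); apply/asboolP; rewrite /label pickleK.
  rewrite size_mkseq; split=> // l Nl i li yi; rewrite size_mkseq in li.
  by apply: (dN i); rewrite /= ?li ?yi // (leq_trans Nl) // -li level_le.
move=> ex; case: (ex_minnP ex) => n /asboolP fn nmin; exists n; split=> // k kn.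
by move=> /asboolP/nmin; lia.
Qed.

Lemma borel_label f n : borel [set y | label y f n].
Proof.
rewrite /label; case: unpickle => [[m s]|]; last exact: borel_cst.
have -> : [set y | [/\ rigid (unguessed y) m (size s),
    forall l, (m <= l)%N -> unguessed y (mkseq (bits f) l) & s = mkseq (bits f) (size s)]] =
   [set y | rigid (unguessed y) m (size s) /\
     ((forall l, (m <= l)%N -> unguessed y (mkseq (bits f) l)) /\ s = mkseq (bits f) (size s))].
  by apply/seteqP; split=> y /= => [[]|[? []]].
apply: borel_and (borel_rigid _ _) _; apply: borel_and (borel_cst _).
by apply: borel_forall => l; apply: borel_imply (borel_unguessed _); exact: borel_cst.
Qed.

Lemma borel_first_label f n : borel [set y | first_label y f n].
Proof.
apply: borel_and (borel_label _ _) _; apply: borel_forall => k.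
apply: borel_imply; first exact: borel_cst.
exact: borel_not (borel_label _ _).
Qed.

(** Were every piece non-dominating, the countable witnesses [D n] together with [C] (index [None])
    would form a countable set; a [y] in [A] eventually different from all of it lies in some [B n],
    against [D n]. *)
Lemma omega_dominating_split (A : set baire) (B : nat -> set baire) (C : set baire) :
  omega_dominating A -> countable C ->
  (forall y, A y -> (forall x, C x -> ev_diff x y) -> exists n, B n y) ->
  exists n, omega_dominating (A `&` B n).
Proof.
move=> domA cC AB; apply: contrapT => /forallNP nd.
have /choice[D DP] : forall n, exists D : set baire, countable D /\
    forall y, A y -> B n y -> ~ forall x, D x -> ev_diff x y.
  move=> n; have /existsNP[D /not_implyP[cD nD]] := nd n; exists D; split=> // y Ay By xy.
  by apply: nD; exists y.
have [|y Ay yE] := domA (\bigcup_o (if o is Some n then D n else C)).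
  by apply: bigcup_countable => // -[n|] _ //; have [] := DP n.
have [|n By] := AB y Ay; first by move=> x Cx; apply: yE; exists None.
by apply: (DP n).2 Ay By _ => x Dx; apply: yE; exists (Some n).
Qed.

Theorem theorem7p4 :
  exists p : Pneq,
    forces p (is_countable (check Pneq vomega) (check Pneq vreals)).
Proof.
pose p : Pneq := PneqCond borel_thin thin_dominating.
(* A point of a condition turns statements about all its points into uniqueness of the label and of
   the real. *)
have inhabited (q : Pneq) : exists y, pneq_set q y.
  by have [y qy _] := pneq_dominating q (countable0 _); exists y.
exists p; apply: (@forces_countable_reals _ _
  (fun f n (q : Pneq) => forall y, pneq_set q y -> first_label y f n)).
- by move=> f n q r rq h y /rq; exact: h.
- by move=> f m n q hm hn; have [y qy] := inhabited q; exact: first_label_fun (hm y qy) (hn y qy).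
- move=> f g n q hf hg; have [y qy] := inhabited q.
  exact: label_inj (hf y qy).1 (hg y qy).1.
move=> f q qp.
(* Every [y] in [q] eventually different from the guesses of [bits f] has a first label for [f], so
   some label is constant on a dominating Borel part of [q], which is the required extension. *)
have [|y qy xy|n dn] := @omega_dominating_split q (fun n => [set y | first_label y f n])
  [set fun i => pickle (mkseq (bits f) (level i))] (pneq_dominating q).
- exact: countable1.
- by apply: label_exists; [exact: qp | exact: xy].
have bn : borel (pneq_set q `&` [set y | first_label y f n]).
  exact: borel_and (pneq_borel q) (borel_first_label f n).
by exists (PneqCond bn dn : Pneq); [move=> y [] | exists n => y []].
Qed.
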